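(* Let $\alpha_1,\alpha_2,\alpha_3>0$ and put $\lambda=\alpha_1+\alpha_2+\alpha_3$. Then there exist 9 vectors $(e_{ij})_{i,j=1}^3$ in a two-dimensional complex Hilbert space $\mathcal H$ such that (a) $\|e_{ii}\|^2=(\lambda-\alpha_i)(\lambda\alpha_i-1)$, $i=1,2,3$; (b) $\|e_{ij}\|^2=\alpha_i+\alpha_j-\lambda\alpha_i\alpha_j$, $i\ne j$; (c) $\sum_{j=1}^3e_{ij}\otimes\overline e_{ij}=\alpha_iI_{\mathcal H}$, $i=1,2,3$; (d) $\sum_{i=1}^3e_{ij}\otimes\overline e_{ij}=\alpha_jI_{\mathcal H}$, $j=1,2,3$, if and only if (i) $\lambda\alpha_i-1\ge0$, $i=1,2,3$; (ii) $\alpha_i^2-\lambda\alpha_i+1\ge0$, $i=1,2,3$; (iii) $4\lambda\alpha_1\alpha_2\alpha_3-4(\alpha_1\alpha_2+\alpha_1\alpha_3+\alpha_2\alpha_3)+3\ge0$.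
   Context: For vectors $x,y$ in a Hilbert space, $x\otimes\overline y$ denotes the operator $z\mapsto(z,y)x$; $I_{\mathcal H}$ is the identity operator. *)

(* Defs.v *)
From HB Require Import structures.
From mathcomp Require Import all_boot all_order all_algebra.
From mathcomp Require Import reals complex.

Set Implicit Arguments.
Unset Strict Implicit.
Unset Printing Implicit Defensive.

Import Order.TTheory GRing.Theory Num.Theory.
Local Open Scope ring_scope.
Local Open Scope complex_scope.

(* A finite-dimensional complex Hilbert space is a [vectType] over R[i] with a
   positive definite form [{dot H for Num.Def.conjC}], linear in its first argument and
   conjugate-linear in its second; completeness is automatic. *)
Section HilbertSpace.
Context {R : realType} {H : vectType R[i]} (form : {dot H for Num.Def.conjC}).

(* Real-valued: [form x x] is a nonnegative complex number. *)
Definition hnorm (x : H) : R := Num.sqrt (complex.Re (form x x)).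

Lemma sqr_hnorm (x : H) : (hnorm x ^+ 2)%:C = form x x.
Proof.
have := dnorm_ge0 form x; rewrite /hnorm; case: (form x x) => a b.
by rewrite lecE /= => /andP[/eqP -> a_ge0]; rewrite sqr_sqrtr.
Qed.

Definition rank_one_fun (x y z : H) : H := form z y *: x.

Lemma rank_one_fun_is_linear (x y : H) : linear (rank_one_fun x y).
Proof.
by move=> a u v; rewrite /rank_one_fun linearPl scalerDl -scalerA.
Qed.

HB.instance Definition _ (x y : H) :=
  GRing.isLinear.Build R[i] H H *:%R (rank_one_fun x y)
    (rank_one_fun_is_linear x y).

Definition rank_one (x y : H) : 'End(H) := linfun (rank_one_fun x y).

Lemma rank_oneE (x y z : H) : rank_one x y z = form z y *: x.
Proof. by rewrite lfunE. Qed.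

End HilbertSpace.

(* Main.v *)
Require Import Defs.
From mathcomp Require Import all_boot all_order all_algebra.
From mathcomp Require Import reals complex.
From mathcomp Require Import ring lra.

Set Implicit Arguments.
Unset Strict Implicit.
Unset Printing Implicit Defensive.

Import Order.TTheory GRing.Theory Num.Theory.
Local Open Scope ring_scope.
Local Open Scope complex_scope.

(** In an orthonormal basis of a two-dimensional space, the operator attached
    to e is (|e|^2 I + v.sigma) / 2, where sigma is the triple of Pauli matrices
    and v in R^3, the Bloch vector of e, has length |e|^2; every vector of R^3
    is a Bloch vector ([bloch_norm], [bloch_surj]).  A sum of such operators is
    t I exactly when the squared norms add up to 2 t and the Bloch vectors add
    up to 0 ([sum_rank_one_scalar]).  The prescribed squared norms already have
    the right sums along rows and columns, so the question becomes: is there a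
    3 x 3 array of vectors of R^3 with prescribed lengths and with all row sums
    and column sums zero?

    Put x_i = lambda alpha_i - 1, which is nonnegative by condition (i), or
    because the diagonal lengths are, and multiply all lengths by lambda.  Since
    lambda^2 = 3 + x_0 + x_1 + x_2, the lengths become 1 - x_i x_j off the
    diagonal and x_i (2 + x_j + x_l) on it, condition (ii) becomes
    1 - x_i (1 + x_j + x_l) >= 0 ([slack]), which is a triangle inequality in
    row i, and condition (iii) becomes
    1 - (x_0 + x_1 + x_2) + 4 x_0 x_1 x_2 >= 0 ([cubic]).

    An array with zero row and column sums is given by three vectors p, q, r
    (the off-diagonal part of its symmetric part) and one vector k (its
    antisymmetric part), see [magic].  As the lengths are symmetric in (i, j),
    k is orthogonal to p, q and r, and the lengths determine the Gram matrix
    G(K) of p, q, r in terms of K = |k|^2; it is affine in K.  So an array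
    exists if and only if, for some K >= 0, the matrix G(K) is positive
    semidefinite and k has room in R^3, that is, K = 0 or det G(K) = 0.

    The principal minors of order two of G(K) and its determinant factor, see
    [minorE] and [gramdetE]:
      det G(K) = 4 (K - K1) Q(K),
    where K1 = (1 - x_0 - x_1 - x_2) (1 + x_0) (1 + x_1) (1 + x_2) and Q is a
    monic quadratic polynomial with Q(0) = (1 + x_0) (1 + x_1) (1 + x_2) times
    the scaled quantity of condition (iii).  If x_0 + x_1 + x_2 <= 1, then
    K = K1 works ([minor_root1]); otherwise K = 0 works ([pencil_psd]).
    Conversely, suppose that (iii) fails.  Then K1 < 0, so that Q(K) >= 0,
    whereas Q < 0 at 0 and at the largest value allowed by a suitable minor of
    order two ([quad_bound]); this contradicts the convexity of Q
    ([cubic_ge0_neq], [cubic_ge0]). *)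

(** * The Gram pencil *)

Section Pencil.
Context {R : realFieldType}.
Implicit Types a b c d e f k x y z : R.

(** Determinant of the symmetric matrix with diagonal a, b, c and off-diagonal
    entries d (first and second rows), e (first and third), f (second and
    third). *)
Definition gram3 a b c d e f : R :=
  a * b * c + 2 * d * e * f - a * f ^+ 2 - b * e ^+ 2 - c * d ^+ 2.

(** The scaled lengths of an off-diagonal entry and of the diagonal entry in the
    row of x. *)
Definition off x y : R := 1 - x * y.
Definition dia x y z : R := x * (2 + y + z).

(** The inner product of the two off-diagonal vectors of the symmetric part in
    the row of x, as forced by the lengths when the antisymmetric part has
    squared length k. *)
Definition cross x y z k : R :=
  (dia x y z ^+ 2 - off x y ^+ 2 - off x z ^+ 2) / 2 + k.

(** Half of the defect in the triangle inequality bounding the diagonal length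
    in the row of x by the two other lengths. *)
Definition slack x y z : R := 1 - x * (1 + y + z).

(** The scaled quantity of condition (iii). *)
Definition cubic x y z : R := 1 - (x + y + z) + 4 * (x * y * z).

(** The positive factor common to the minors and the determinant. *)
Definition vol x y z : R := (1 + x) * (1 + y) * (1 + z).

(** The linear root of the determinant of the Gram pencil. *)
Definition root1 x y z : R := (1 - (x + y + z)) * vol x y z.

(** The principal minor of order two of the Gram pencil that belongs to the row
    of x, and the determinant of the pencil. *)
Definition minor x y z k : R :=
  (off x y ^+ 2 - k) * (off x z ^+ 2 - k) - cross x y z k ^+ 2.
Definition gramdet x y z k : R :=
  gram3 (off y z ^+ 2 - k) (off x z ^+ 2 - k) (off x y ^+ 2 - k)
    (cross z x y k) (cross y x z k) (cross x y z k).

(** The monic quadratic factor of the determinant of the pencil is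
    [quad]; [mid] is the sum of its roots. *)
Definition mid x y z : R :=
  off x y ^+ 2 + off x z ^+ 2 + off y z ^+ 2
  - (dia x y z ^+ 2 + dia y x z ^+ 2 + dia z x y ^+ 2) / 2 - root1 x y z.
Definition quad x y z k : R :=
  k ^+ 2 - mid x y z * k + vol x y z * cubic x y z.

Lemma minorE x y z k : minor x y z k =
  x ^+ 2 * (4 * vol x y z * slack x y z - k * (2 + y + z) ^+ 2).
Proof. by rewrite /minor /cross /off /dia /vol /slack; field. Qed.

Lemma gramdetE x y z k :
  gramdet x y z k = 4 * (k - root1 x y z) * quad x y z k.
Proof.
by rewrite /gramdet /gram3 /quad /mid /root1 /cross /off /dia /vol /cubic; field.
Qed.

Lemma minor_root1 x y z : minor x y z (root1 x y z) =
  x ^+ 2 * (y + z) ^+ 2 * vol x y z * (3 + (x + y + z)).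
Proof. by rewrite minorE /root1 /slack; ring. Qed.

(** The value of the quadratic factor where the minor of the row of x vanishes
    (for x nonzero, see [minorE]): it is nonpositive, and negative when x > 0
    and y <> z. *)
Lemma quad_bound x y z k :
  k * (2 + y + z) ^+ 2 = 4 * vol x y z * slack x y z ->
  quad x y z k * (2 + y + z) ^+ 4 =
  - (vol x y z * (3 + (x + y + z)) * (y - z) ^+ 2
       * (y + z + 2 * x * (1 + y + z)) ^+ 2).
Proof.
move=> kE.
have -> : quad x y z k * (2 + y + z) ^+ 4 = (k * (2 + y + z) ^+ 2) ^+ 2
  - mid x y z * (2 + y + z) ^+ 2 * (k * (2 + y + z) ^+ 2)
  + vol x y z * cubic x y z * (2 + y + z) ^+ 4 by rewrite /quad; ring.
by rewrite kE /mid /root1 /off /dia /vol /slack /cubic; field.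
Qed.

Lemma vol_gt0 x y z : 0 <= x -> 0 <= y -> 0 <= z -> 0 < vol x y z.
Proof. by move=> x0 y0 z0; rewrite /vol !mulr_gt0 //; lra. Qed.

Lemma slack_ge0 x y z k : 0 <= x -> 0 <= y -> 0 <= z -> 0 <= k ->
  0 <= minor x y z k -> 0 <= slack x y z.
Proof.
move=> x0 y0 z0 k0; rewrite minorE.
have [->|xn0] := eqVneq x 0; first by rewrite /slack mul0r subr0.
have x2 : 0 < x ^+ 2 by rewrite exprn_gt0 // lt0r xn0.
rewrite pmulr_rge0 // subr_ge0 => h.
have /le_trans/(_ h) : 0 <= k * (2 + y + z) ^+ 2 by rewrite mulr_ge0 ?sqr_ge0.
by rewrite pmulr_rge0 // mulr_gt0 ?vol_gt0.
Qed.

(** Necessity of condition (iii), in a row whose minor gives a strict bound. *)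
Lemma cubic_ge0_neq x y z k : 0 < x -> 0 <= y -> 0 <= z -> y != z -> 0 <= k ->
  0 <= minor x y z k -> 0 <= gramdet x y z k -> 0 <= cubic x y z.
Proof.
move=> x0 y0 z0 yz k0; rewrite minorE gramdetE => hm hd.
rewrite leNgt; apply/negP => c0.
have V0 : 0 < vol x y z by rewrite vol_gt0 // ltW.
have s0 : 0 < (2 + y + z) ^+ 2 by rewrite exprn_gt0 //; lra.
have e0 : 0 <= x * y * z by rewrite !mulr_ge0 // ltW.
have r0 : root1 x y z < 0.
  by rewrite /root1 pmulr_llt0 //; move: c0 e0; rewrite /cubic; lra.
have qk : 0 <= quad x y z k by move: hd; rewrite pmulr_rge0 //; lra.
(* K is the largest value of k allowed by the minor. *)
have [K KE] : exists K, K * (2 + y + z) ^+ 2 = 4 * vol x y z * slack x y z.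
  exists (4 * vol x y z * slack x y z / (2 + y + z) ^+ 2).
  by rewrite divfK // gt_eqF.
have kK : k <= K.
  move: hm; rewrite -KE -mulrBl pmulr_rge0 ?exprn_gt0 //.
  by rewrite pmulr_lge0 // subr_ge0.
have qK : quad x y z K < 0.
  have : quad x y z K * (2 + y + z) ^+ 4 < 0.
    rewrite quad_bound // oppr_lt0.
    have l3 : 0 < 3 + (x + y + z) by lra.
    have d0 : 0 < (y - z) ^+ 2 by rewrite exprn_even_gt0 //= subr_eq0.
    have t0 : 0 < (y + z + 2 * x * (1 + y + z)) ^+ 2.
      rewrite exprn_gt0 // ltr_wpDl ?addr_ge0 // !mulr_gt0 //; lra.
    exact: mulr_gt0 (mulr_gt0 (mulr_gt0 V0 l3) d0) t0.
  by rewrite pmulr_llt0 // exprn_gt0 //; lra.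
have q0 : quad x y z 0 < 0.
  by rewrite /quad expr0n mulr0 subr0 add0r pmulr_rlt0.
have convex : K * quad x y z k
  = (K - k) * quad x y z 0 + k * quad x y z K - k * (K * (K - k)).
  by rewrite /quad; ring.
have K0 : 0 <= K := le_trans k0 kK.
have h1 : 0 <= K * quad x y z k by apply: mulr_ge0.
have h2 : 0 <= k * (K * (K - k)).
  by do 2!apply: mulr_ge0 => //; rewrite subr_ge0.
have h3 : (K - k) * quad x y z 0 <= 0 by rewrite mulr_ge0_le0 ?subr_ge0 // ltW.
have h4 : k * quad x y z K <= 0 by rewrite mulr_ge0_le0 // ltW.
have /eqP : k * quad x y z K = 0 by lra.
rewrite mulf_eq0 (lt_eqF qK) orbF => /eqP kz.
by move: qk; rewrite kz leNgt q0.
Qed.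

Lemma gramdet_swap12 x y z k : gramdet y x z k = gramdet x y z k.
Proof. by rewrite /gramdet /gram3 /cross /off /dia; ring. Qed.

(** Necessity of condition (iii).  Some row satisfies the hypotheses of
    [cubic_ge0_neq] unless all three arguments are equal, or two of them are 0;
    these cases are settled directly. *)
Lemma cubic_ge0 x y z k : 0 <= x -> 0 <= y -> 0 <= z -> 0 <= k ->
  0 <= minor x y z k -> 0 <= minor y x z k -> 0 <= minor z y x k ->
  0 <= gramdet x y z k -> 0 <= cubic x y z.
Proof.
move=> x0 y0 z0 k0 m1 m2 m3 hd.
have [yz|yz] := eqVneq y z; last have [x00|xn0] := eqVneq x 0.
- have [xz|xz] := eqVneq x z.
    have -> : cubic x y z = (1 - 2 * x) ^+ 2 * (1 + x).
      by rewrite yz -xz /cubic; ring.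
    by rewrite mulr_ge0 ?sqr_ge0 // addr_ge0.
  have [y00|yn0] := eqVneq y 0.
    have := slack_ge0 x0 y0 z0 k0 m1; rewrite -yz y00 /slack /cubic; lra.
  have -> : cubic x y z = cubic y x z by rewrite /cubic; ring.
  have yp : 0 < y by rewrite lt0r yn0.
  have hd' : 0 <= gramdet y x z k by rewrite gramdet_swap12.
  exact: cubic_ge0_neq yp x0 z0 xz k0 m2 hd'.
- have [y00|yn0] := eqVneq y 0.
    by have := slack_ge0 z0 y0 x0 k0 m3; rewrite x00 y00 /slack /cubic; lra.
  have [z00|zn0] := eqVneq z 0.
    by have := slack_ge0 y0 x0 z0 k0 m2; rewrite x00 z00 /slack /cubic; lra.
  have -> : cubic x y z = cubic y x z by rewrite /cubic; ring.
  have yp : 0 < y by rewrite lt0r yn0.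
  have xz : x != z by rewrite x00 eq_sym.
  have hd' : 0 <= gramdet y x z k by rewrite gramdet_swap12.
  exact: cubic_ge0_neq yp x0 z0 xz k0 m2 hd'.
- have xp : 0 < x by rewrite lt0r xn0.
  exact: cubic_ge0_neq xp y0 z0 yz k0 m1 hd.
Qed.

(** The diagonal entries of the Gram pencil are nonnegative at [root1]. *)
Lemma off_ge_root1 x y z : 0 <= x -> 0 <= y -> 0 <= z -> x + y + z <= 1 ->
  0 <= off x y ^+ 2 - root1 x y z.
Proof.
move=> x0 y0 z0 e1.
have -> : off x y ^+ 2 - root1 x y z =
  (x - y) ^+ 2 + x * y * (1 + x + y + x * y)
  + z * (x + y + z) * ((1 + x) * (1 + y)).
  by rewrite /off /root1 /vol; ring.
by rewrite !addr_ge0 ?sqr_ge0 // !mulr_ge0 // !addr_ge0 // mulr_ge0.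
Qed.

(** Under the conditions (i)-(iii) some member of the pencil with k >= 0 is
    positive semidefinite, and it is singular unless k = 0. *)
Lemma pencil_psd x y z : 0 <= x -> 0 <= y -> 0 <= z ->
  0 <= slack x y z -> 0 <= slack y x z -> 0 <= slack z y x ->
  0 <= cubic x y z ->
  exists2 k, 0 <= k & [/\ [/\ 0 <= off x y ^+ 2 - k, 0 <= off x z ^+ 2 - k
    & 0 <= off y z ^+ 2 - k],
   [/\ 0 <= minor x y z k, 0 <= minor y x z k & 0 <= minor z y x k],
   0 <= gramdet x y z k & k = 0 \/ gramdet x y z k = 0].
Proof.
move=> x0 y0 z0 s1 s2 s3 c0.
have [e1|e1] := leP (x + y + z) 1.
  have eyx : root1 y x z = root1 x y z by rewrite /root1 /vol; ring.
  have ezx : root1 z y x = root1 x y z by rewrite /root1 /vol; ring.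
  have ezy : root1 x z y = root1 x y z by rewrite /root1 /vol; ring.
  have eyz : root1 y z x = root1 x y z by rewrite /root1 /vol; ring.
  have d0 : gramdet x y z (root1 x y z) = 0.
    by rewrite gramdetE subrr mulr0 mul0r.
  have V a b c : 0 <= a -> 0 <= b -> 0 <= c -> 0 <= minor a b c (root1 a b c).
    move=> a0 b0 c00; have V0 := ltW (vol_gt0 a0 b0 c00).
    rewrite minor_root1.
    rewrite (mulr_ge0 (mulr_ge0 (mulr_ge0 (sqr_ge0 a) (sqr_ge0 _)) V0)) //.
    by rewrite !addr_ge0.
  exists (root1 x y z); first by rewrite mulr_ge0 ?subr_ge0 // ltW ?vol_gt0.
  split; rewrite ?d0 //; last by right.
    split; first exact: off_ge_root1.
      by rewrite -ezy off_ge_root1 // addrAC.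
    by rewrite -eyz off_ge_root1 // addrC addrA.
  by split; [|rewrite -eyx|rewrite -ezx]; apply: V.
exists 0; first exact: lexx.
have V a b c : 0 <= a -> 0 <= b -> 0 <= c -> 0 <= slack a b c ->
    0 <= minor a b c 0.
  move=> a0 b0 c00 s0; have V0 := ltW (vol_gt0 a0 b0 c00).
  rewrite minorE mul0r subr0.
  exact: mulr_ge0 (sqr_ge0 a) (mulr_ge0 (mulr_ge0 (ler0n _ 4) V0) s0).
split; last by left.
- by rewrite !subr0; split; apply: sqr_ge0.
- by split; apply: V.
- have V0 := ltW (vol_gt0 x0 y0 z0).
  have r0 : root1 x y z <= 0 by rewrite mulr_le0_ge0 // subr_le0 ltW.
  rewrite gramdetE sub0r /quad expr0n mulr0 subr0 add0r.
  by rewrite mulr_ge0 // mulr_ge0 // oppr_ge0.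
Qed.
End Pencil.

(** * Vectors of R^3 and their Gram matrices *)

Lemma forall_ord3 (P : 'I_3 -> Prop) : P 0 -> P 1 -> P 2 -> forall i, P i.
Proof.
move=> P0 P1 P2 [[|[|[|m]]] lt_m3] //.
- by rewrite (_ : Ordinal _ = 0) //; apply: val_inj.
- by rewrite (_ : Ordinal _ = 1) //; apply: val_inj.
- by rewrite (_ : Ordinal _ = 2) //; apply: val_inj.
Qed.

Lemma sum_ord3 (V : nmodType) (F : 'I_3 -> V) :
  \sum_(i < 3) F i = F 0 + F 1 + F 2.
Proof.
rewrite !big_ord_recl big_ord0 addr0 addrA.
by congr (_ + F _ + F _); apply: val_inj.
Qed.

Section Dot.
Context {R : rcfType}.
Implicit Types p u v : 'rV[R]_3.

(** The Euclidean inner product of R^3. *)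
Definition dot u v : R := \sum_i u 0 i * v 0 i.

Lemma dotE u v : dot u v = u 0 0 * v 0 0 + u 0 1 * v 0 1 + u 0 2 * v 0 2.
Proof. exact: sum_ord3. Qed.

Lemma dotC u v : dot u v = dot v u.
Proof. by apply: eq_bigr => i _; rewrite mulrC. Qed.

Lemma dotDl p u v : dot (u + v) p = dot u p + dot v p.
Proof. by rewrite -big_split; apply: eq_bigr => i _; rewrite mxE mulrDl. Qed.

Lemma dotZl a u v : dot (a *: u) v = a * dot u v.
Proof. by rewrite [RHS]mulr_sumr; apply: eq_bigr => i _; rewrite mxE mulrA. Qed.

Lemma dotNl u v : dot (- u) v = - dot u v.
Proof. by rewrite -scaleN1r dotZl mulN1r. Qed.

Lemma dot_sqrD u v : dot (u + v) (u + v) = dot u u + 2 * dot u v + dot v v.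
Proof. by rewrite dotDl 2!(dotC _ (u + v)) !dotDl (dotC v u); ring. Qed.

Lemma dot_sqrN u : dot (- u) (- u) = dot u u.
Proof. by rewrite dotNl dotC dotNl opprK. Qed.

Lemma dot_sqrB u v : dot (u - v) (u - v) = dot u u - 2 * dot u v + dot v v.
Proof. by rewrite dot_sqrD dot_sqrN dotC dotNl (dotC v); ring. Qed.

Definition vec3 (x y z : R) : 'rV[R]_3 := \row_i [:: x; y; z]`_i.

Lemma vec3E x y z :
  (vec3 x y z 0 0 = x) * (vec3 x y z 0 1 = y) * (vec3 x y z 0 2 = z).
Proof. by rewrite !mxE. Qed.

Lemma dot_vec3 a b c x y z :
  dot (vec3 a b c) (vec3 x y z) = a * x + b * y + c * z.
Proof. by rewrite dotE !vec3E. Qed.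

Lemma dot_ge0 u : 0 <= dot u u.
Proof. by rewrite sumr_ge0 // => i _; rewrite -expr2 sqr_ge0. Qed.

Lemma dot_Cauchy u v : dot u v ^+ 2 <= dot u u * dot v v.
Proof.
rewrite -subr_ge0 !dotE.
set a := u 0 0; set b := u 0 1; set c := u 0 2.
set x := v 0 0; set y := v 0 1; set z := v 0 2.
have -> : (a * a + b * b + c * c) * (x * x + y * y + z * z)
    - (a * x + b * y + c * z) ^+ 2 =
  (a * y - b * x) ^+ 2 + (a * z - c * x) ^+ 2 + (b * z - c * y) ^+ 2 by ring.
by rewrite !addr_ge0 ?sqr_ge0.
Qed.

Lemma gram3_ge0 p q r :
  0 <= gram3 (dot p p) (dot q q) (dot r r) (dot p q) (dot p r) (dot q r).
Proof.
rewrite /gram3 !dotE.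
set a := p 0 0; set b := p 0 1; set c := p 0 2.
set x := q 0 0; set y := q 0 1; set z := q 0 2.
set l := r 0 0; set m := r 0 1; set n := r 0 2.
rewrite [leRHS](_ : _ =
  (a * (y * n - z * m) - b * (x * n - z * l) + c * (x * m - y * l)) ^+ 2).
  exact: sqr_ge0.
ring.
Qed.

(** A symmetric matrix of order two, with diagonal b, c and off-diagonal entry
    f, whose principal minors are nonnegative is the Gram matrix of two vectors
    of the plane; these are on the first axis if it is singular. *)
Lemma gram2_realize (b c f : R) : 0 <= b -> 0 <= c -> f ^+ 2 <= b * c ->
  exists x1 x2 y1 y2 : R, [/\ x1 ^+ 2 + x2 ^+ 2 = b, y1 ^+ 2 + y2 ^+ 2 = c,
    x1 * y1 + x2 * y2 = f & b * c = f ^+ 2 -> x2 = 0 /\ y2 = 0].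
Proof.
move=> b0 c0 fbc; have [bz|bn0] := eqVneq b 0.
  have f0 : f = 0.
    apply/eqP; rewrite -sqrf_eq0 eq_le sqr_ge0 andbT.
    by rewrite (le_trans fbc) // bz mul0r.
  exists 0, 0, (Num.sqrt c), 0; rewrite sqr_sqrtr // bz f0.
  by split=> //; ring.
have bgt : 0 < b by rewrite lt0r bn0.
have sb0 : Num.sqrt b != 0 by rewrite gt_eqF // sqrtr_gt0.
have d0 : 0 <= c - f ^+ 2 / b by rewrite subr_ge0 ler_pdivrMr // mulrC.
exists (Num.sqrt b), 0, (f / Num.sqrt b), (Num.sqrt (c - f ^+ 2 / b)); split.
- by rewrite sqr_sqrtr // expr0n addr0.
- by rewrite sqr_sqrtr // expr_div_n sqr_sqrtr // subrKC.
- by rewrite mul0r addr0 mulrC divfK.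
- by move=> h; rewrite -h mulrAC divff // mul1r subrr sqrtr0.
Qed.

(** A symmetric matrix of order three whose principal minors are all nonnegative
    is the Gram matrix of three vectors of R^3; these lie in a plane if it is
    singular. *)
Lemma gram3_realize (a b c d e f : R) : 0 <= a -> 0 <= b -> 0 <= c ->
  d ^+ 2 <= a * b -> e ^+ 2 <= a * c -> f ^+ 2 <= b * c ->
  0 <= gram3 a b c d e f ->
  exists p q r, [/\ [/\ dot p p = a, dot q q = b & dot r r = c],
    [/\ dot p q = d, dot p r = e & dot q r = f]
    & gram3 a b c d e f = 0 -> exists n,
      [/\ dot n n = 1, dot n p = 0, dot n q = 0 & dot n r = 0]].
Proof.
move=> a0 b0 c0 dab eac fbc; rewrite /gram3 => g0; have [az|an0] := eqVneq a 0.
  have d0 : d = 0.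
    apply/eqP; rewrite -sqrf_eq0 eq_le sqr_ge0 andbT.
    by rewrite (le_trans dab) // az mul0r.
  have e0 : e = 0.
    apply/eqP; rewrite -sqrf_eq0 eq_le sqr_ge0 andbT.
    by rewrite (le_trans eac) // az mul0r.
  have [x1 [x2 [y1 [y2 [xx yy xy _]]]]] := gram2_realize b0 c0 fbc.
  exists (vec3 0 0 0), (vec3 x1 x2 0), (vec3 y1 y2 0).
  rewrite !dot_vec3 az d0 e0 -xx -yy -xy; split; [by split; ring| by split; ring|].
  by move=> _; exists (vec3 0 0 1); rewrite !dot_vec3; split; ring.
have ap : 0 < a by rewrite lt0r an0.
have sa0 : Num.sqrt a != 0 by rewrite gt_eqF // sqrtr_gt0.
have sa2 : Num.sqrt a ^+ 2 = a by rewrite sqr_sqrtr.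
set s := Num.sqrt a in sa0 sa2.
have b'0 : 0 <= b - (d / s) ^+ 2.
  by rewrite expr_div_n sa2 subr_ge0 ler_pdivrMr // mulrC.
have c'0 : 0 <= c - (e / s) ^+ 2.
  by rewrite expr_div_n sa2 subr_ge0 ler_pdivrMr // mulrC.
(* The last two coordinates of q and r realize the Schur complement of a. *)
have schur : (b - (d / s) ^+ 2) * (c - (e / s) ^+ 2) - (f - d / s * (e / s)) ^+ 2
  = (a * b * c + 2 * d * e * f - a * f ^+ 2 - b * e ^+ 2 - c * d ^+ 2) / a.
  by rewrite -sa2; field.
have f'0 : (f - d / s * (e / s)) ^+ 2 <= (b - (d / s) ^+ 2) * (c - (e / s) ^+ 2).
  by rewrite -subr_ge0 schur divr_ge0.
have [x1 [x2 [y1 [y2 [xx yy xy flat]]]]] := gram2_realize b'0 c'0 f'0.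
exists (vec3 s 0 0), (vec3 (d / s) x1 x2), (vec3 (e / s) y1 y2).
rewrite !dot_vec3; split.
- split; first by rewrite -expr2 sa2; ring.
    by rewrite -[b](subrK ((d / s) ^+ 2)) -xx; ring.
  by rewrite -[c](subrK ((e / s) ^+ 2)) -yy; ring.
- split; [by field|by field|].
  by rewrite -[f](subrK (d / s * (e / s))) -xy; ring.
- move=> g00; have [-> ->] : x2 = 0 /\ y2 = 0.
    by apply/flat/eqP; rewrite -subr_eq0 schur g00 mul0r.
  by exists (vec3 0 0 1); rewrite !dot_vec3; split; ring.
Qed.
End Dot.

(** * Arrays of vectors with zero row and column sums *)

Section Config.
Context {R : rcfType}.
Implicit Types (p q r k : 'rV[R]_3) (w : 'I_3 -> 'I_3 -> 'rV[R]_3).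

(** The arrays whose rows and columns all add up to 0. *)
Definition magic0 w :=
  (forall i, \sum_j w i j = 0) /\ (forall j, \sum_i w i j = 0).

(** The general array with zero row and column sums; p, q, r and k are recovered
    from its symmetric and antisymmetric parts. *)
Definition magic p q r k : 'I_3 -> 'I_3 -> 'rV[R]_3 := fun i j =>
  nth 0 (nth [::] [:: [:: - (q + r); r + k; q - k];
                      [:: r - k; - (p + r); p + k];
                      [:: q + k; p - k; - (p + q)]] i) j.

Lemma magic_magic0 p q r k : magic0 (magic p q r k).
Proof.
split; apply: forall_ord3; rewrite sum_ord3 /magic /=;
  by apply/rowP => c; rewrite !mxE; ring.
Qed.

Lemma magic0P w : magic0 w ->
  exists p q r k, forall i j, w i j = magic p q r k i j.
Proof.
move=> [rows cols].
exists (2^-1 *: (w 1 2 + w 2 1)), (2^-1 *: (w 0 2 + w 2 0)),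
  (2^-1 *: (w 0 1 + w 1 0)), (2^-1 *: (w 0 1 - w 1 0)).
have E c i : w i 0 0 c + w i 1 0 c + w i 2 0 c = 0.
  by have /rowP/(_ c) := rows i; rewrite sum_ord3 !mxE.
have F c j : w 0 j 0 c + w 1 j 0 c + w 2 j 0 c = 0.
  by have /rowP/(_ c) := cols j; rewrite sum_ord3 !mxE.
do 2!apply: forall_ord3; apply/rowP => c; rewrite /magic /= !mxE;
  move: (E c 0) (E c 1) (E c 2) (F c 0) (F c 1) (F c 2); lra.
Qed.

(** The scaled length of entry (i, j); [b 0 + b 1 + b 2 - b i] is the sum of the
    two values of b at the indices other than i. *)
Definition len (b : 'I_3 -> R) i j : R :=
  if i == j then b i * (2 + (b 0 + b 1 + b 2 - b i)) else 1 - b i * b j.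

(** The geometric form of the theorem: a condition for the existence of nine
    vectors of R^3 with prescribed lengths and zero row and column sums. *)
Lemma config_iff (b : 'I_3 -> R) : (forall i, 0 <= b i) ->
  (exists2 w, magic0 w & forall i j, dot (w i j) (w i j) = len b i j ^+ 2) <->
  (forall i, 0 <= 1 - b i * (1 + (b 0 + b 1 + b 2 - b i))) /\
  0 <= cubic (b 0) (b 1) (b 2).
Proof.
move=> b0.
have x0 := b0 0; have y0 := b0 1; have z0 := b0 2.
have l00 : len b 0 0 = dia (b 0) (b 1) (b 2) by rewrite /len /dia /=; ring.
have l11 : len b 1 1 = dia (b 1) (b 0) (b 2) by rewrite /len /dia /=; ring.
have l22 : len b 2 2 = dia (b 2) (b 0) (b 1) by rewrite /len /dia /=; ring.
have slP : (forall i, 0 <= 1 - b i * (1 + (b 0 + b 1 + b 2 - b i))) <->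
  [/\ 0 <= slack (b 0) (b 1) (b 2), 0 <= slack (b 1) (b 0) (b 2)
    & 0 <= slack (b 2) (b 1) (b 0)].
  rewrite /slack; split=> [sl|[sl0 sl1 sl2]].
    by split; [move: (sl 0)|move: (sl 1)|move: (sl 2)]; lra.
  by apply: forall_ord3; lra.
have [l01 l02 l12] : [/\ len b 0 1 = off (b 0) (b 1),
  len b 0 2 = off (b 0) (b 2) & len b 1 2 = off (b 1) (b 2)] by [].
have [l10 l20 l21] : [/\ len b 1 0 = off (b 0) (b 1),
  len b 2 0 = off (b 0) (b 2) & len b 2 1 = off (b 1) (b 2)].
  by split; rewrite /len /off /= mulrC.
move: (b 0) (b 1) (b 2) x0 y0 z0 l00 l11 l22 slP l01 l02 l12 l10 l20 l21
  => x y z x0 y0 z0 l00 l11 l22 slP l01 l02 l12 l10 l20 l21.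
have offC (s t : R) : off s t = off t s by rewrite /off mulrC.
have crossC (s t m n : R) : cross s t m n = cross s m t n.
  by rewrite /cross /off /dia; ring.
split.
  move=> [w /magic0P[p [q [r [k wE]]]]] wlen.
  have {}wlen i j : dot (magic p q r k i j) (magic p q r k i j) = len b i j ^+ 2.
    by rewrite -wE.
  have := wlen 0 0; rewrite l00 /magic /= dot_sqrN dot_sqrD => h00.
  have := wlen 1 1; rewrite l11 /magic /= dot_sqrN dot_sqrD => h11.
  have := wlen 2 2; rewrite l22 /magic /= dot_sqrN dot_sqrD => h22.
  have := wlen 0 1; rewrite l01 /magic /= dot_sqrD => h01.
  have := wlen 1 0; rewrite l10 /magic /= dot_sqrB => h10.
  have := wlen 0 2; rewrite l02 /magic /= dot_sqrB => h02.
  have := wlen 2 0; rewrite l20 /magic /= dot_sqrD => h20.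
  have := wlen 1 2; rewrite l12 /magic /= dot_sqrD => h12.
  have := wlen 2 1; rewrite l21 /magic /= dot_sqrB => h21.
  (* The equal lengths of entries (i, j) and (j, i) make k orthogonal to p, q
     and r. *)
  have k0 := dot_ge0 k.
  move: (dot k k) h00 h11 h22 h01 h10 h02 h20 h12 h21 k0
    => K h00 h11 h22 h01 h10 h02 h20 h12 h21 k0.
  have pp : off y z ^+ 2 - K = dot p p by lra.
  have qq : off x z ^+ 2 - K = dot q q by lra.
  have rr : off x y ^+ 2 - K = dot r r by lra.
  have qr : cross x y z K = dot q r by rewrite /cross; lra.
  have pr : cross y x z K = dot p r by rewrite /cross (offC y x); lra.
  have pq : cross z x y K = dot p q.
    by rewrite /cross (offC z x) (offC z y); lra.
  have m1 : 0 <= minor x y z K.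
    by rewrite /minor rr qq qr mulrC subr_ge0 dot_Cauchy.
  have m2 : 0 <= minor y x z K.
    by rewrite /minor (offC y x) rr pp pr mulrC subr_ge0 dot_Cauchy.
  have m3 : 0 <= minor z y x K.
    by rewrite /minor (offC z y) (offC z x) crossC pp qq pq subr_ge0 dot_Cauchy.
  have g0 : 0 <= gramdet x y z K by rewrite /gramdet pp qq rr pq pr qr gram3_ge0.
  split; last exact: cubic_ge0 x0 y0 z0 k0 m1 m2 m3 g0.
  apply/slP; split.
  - exact: slack_ge0 x0 y0 z0 k0 m1.
  - exact: slack_ge0 y0 x0 z0 k0 m2.
  - exact: slack_ge0 z0 y0 x0 k0 m3.
move=> [/slP[sl0 sl1 sl2] c0].
have [K K0 [[rr qq pp] [m1 m2 m3] g0 flat]] :=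
  pencil_psd x0 y0 z0 sl0 sl1 sl2 c0.
have pq : cross z x y K ^+ 2 <= (off y z ^+ 2 - K) * (off x z ^+ 2 - K).
  by rewrite -subr_ge0 crossC; move: m3; rewrite /minor (offC z y) (offC z x).
have pr : cross y x z K ^+ 2 <= (off y z ^+ 2 - K) * (off x y ^+ 2 - K).
  by rewrite -subr_ge0 mulrC; move: m2; rewrite /minor (offC y x).
have qr : cross x y z K ^+ 2 <= (off x z ^+ 2 - K) * (off x y ^+ 2 - K).
  by rewrite -subr_ge0 mulrC.
have [p [q [r [[Epp Eqq Err] [Epq Epr Eqr] normal]]]] :=
  gram3_realize pp qq rr pq pr qr g0.
(* k is 0 or is normal to the plane of p, q and r. *)
have [k [Ekk Epk Eqk Erk]] : exists k,
    [/\ dot k k = K, dot p k = 0, dot q k = 0 & dot r k = 0].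
  have [->|gz] := flat.
    exists (0 *: p); rewrite dotZl mul0r.
    by split=> //; rewrite dotC dotZl mul0r.
  have [n [nn np nq nr]] := normal gz.
  exists (Num.sqrt K *: n); split.
  - by rewrite dotZl dotC dotZl nn mulr1 -expr2 sqr_sqrtr.
  - by rewrite dotC dotZl np mulr0.
  - by rewrite dotC dotZl nq mulr0.
  - by rewrite dotC dotZl nr mulr0.
exists (magic p q r k); first exact: magic_magic0.
have dots := (@dot_sqrN R, @dot_sqrB R, @dot_sqrD R, Epp, Eqq, Err, Epq, Epr, Eqr,
  Ekk, Epk, Eqk, Erk).
do 2!apply: forall_ord3; rewrite /magic /= !dots
  ?(l00, l01, l02, l10, l11, l12, l20, l21, l22) /cross
  ?(offC y x) ?(offC z x) ?(offC z y); by field.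
Qed.
End Config.

(** * Bloch vectors *)

Section Bloch.
Context {R : realType} {H : vectType R[i]} (form : {dot H for Num.Def.conjC}).

(** (u1, u2) is an orthonormal basis of H. *)
Definition onb (u1 u2 : H) : Prop :=
  [/\ form u1 u1 = 1, form u2 u2 = 1, form u1 u2 = 0, form u2 u1 = 0
    & forall z, z = form z u1 *: u1 + form z u2 *: u2].

Lemma formC (x y : H) : form x y = (form y x)^*%R.
Proof. by rewrite hermC expr0 mul1r. Qed.

Lemma unit_multiple (a : H) : a != 0 ->
  exists c : R[i], form (c *: a) (c *: a) = 1.
Proof.
move=> a0; have s0 : sqrtC (form a a) != 0 by rewrite gt_eqF // sqrt_dnorm_gt0.
exists (sqrtC (form a a))^-1.
rewrite dnormZ normfV ger0_norm ?sqrt_dnorm_ge0 // exprVn sqrtCK.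
by rewrite mulVf // dnorm_eq0.
Qed.

Lemma onb_exists : \dim {:H} = 2%N -> exists u1 u2, onb u1 u2.
Proof.
move=> dimH.
have a0 : vpick {:H}%VS != 0 by rewrite vpick0 -dimv_eq0 dimH.
set a := vpick _ in a0.
have b0 : vpick (fullv :&: orthov form <[a]>)%VS != 0.
  by rewrite vpick0 -dimv_eq0 -lt0n (leq_trans _ (leq_dim_orthov1 _ _ _)) ?dimH.
set b := vpick _ in b0.
have ba : form b a = 0.
  have : b \in (fullv :&: orthov form <[a]>)%VS by apply: memv_pick.
  by rewrite memv_cap => /andP[_]; rewrite mem_orthov1 => /eqP.
have [c cE] := unit_multiple a0; have [d dE] := unit_multiple b0.
have u21 : form (d *: b) (c *: a) = 0.
  by rewrite linearZl_LR linearZr_LR /= ba !mulr0.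
have u12 : form (c *: a) (d *: b) = 0 by rewrite formC u21 rmorph0.
exists (c *: a), (d *: b); split=> // z.
move: (c *: a) (d *: b) cE dE u12 u21 => u1 u2 u11 u22 u12 u21.
have fr : free [:: u1; u2].
  by apply/(@orthonormal_free _ _ form)/orthonormal2P.
have bs : basis_of fullv [tuple u1; u2].
  rewrite basisEfree; apply/and3P; split.
  - exact: fr.
  - exact: subvf.
  - by rewrite dimH.
have := coord_basis bs (memvf z); rewrite !big_ord_recl big_ord0 addr0 /=.
move: (coord _ _ z) (coord _ _ z) => y x zE.
have x1 : form z u1 = x.
  by rewrite zE linearDl /= !linearZl_LR /= u11 u21 mulr1 mulr0 addr0.
have y1 : form z u2 = y.
  by rewrite zE linearDl /= !linearZl_LR /= u22 u12 mulr1 mulr0 add0r.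
by rewrite x1 y1.
Qed.

Section Basis.
Variables (u1 u2 : H) (hu : onb u1 u2).
Let u11 : form u1 u1 = 1. Proof. by case: hu. Qed.
Let u22 : form u2 u2 = 1. Proof. by case: hu. Qed.
Let u12 : form u1 u2 = 0. Proof. by case: hu. Qed.
Let u21 : form u2 u1 = 0. Proof. by case: hu. Qed.
Let uE z : z = form z u1 *: u1 + form z u2 *: u2. Proof. by case: hu. Qed.

(** The Bloch vector of e: with x and y the coordinates of e, the vector with
    entries 2 Re (x y^* ), 2 Im (x y^* ) and |x|^2 - |y|^2. *)
Definition bloch (e : H) : 'rV[R]_3 :=
  let: (a, b) := (complex.Re (form e u1), complex.Im (form e u1)) in
  let: (c, d) := (complex.Re (form e u2), complex.Im (form e u2)) in
  vec3 (2 * (a * c + b * d)) (2 * (b * c - a * d))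
    (a ^+ 2 + b ^+ 2 - (c ^+ 2 + d ^+ 2)).

Lemma hnormE e : hnorm form e ^+ 2 =
  complex.Re (form e u1) ^+ 2 + complex.Im (form e u1) ^+ 2
  + (complex.Re (form e u2) ^+ 2 + complex.Im (form e u2) ^+ 2).
Proof.
apply: (@complexI R); rewrite sqr_hnorm rmorphD /= !add_Re2_Im2 !normCK.
rewrite {2}(uE e) linearDr /= !linearZr_LR /=.
by rewrite mulrC [X in _ + X]mulrC.
Qed.

Lemma bloch_norm e : dot (bloch e) (bloch e) = (hnorm form e ^+ 2) ^+ 2.
Proof. by rewrite hnormE /bloch dot_vec3; ring. Qed.

(** Every vector v of R^3 is the Bloch vector of some e with |e|^2 = |v|. *)
Lemma bloch_surj v N : 0 <= N -> dot v v = N ^+ 2 ->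
  exists2 e, hnorm form e ^+ 2 = N & bloch e = v.
Proof.
move=> N0; rewrite dotE => vN.
(* The coordinates of e are a + i b and c + i d; the first can be taken real. *)
suff [a [b [c [d [h1 h2 h3 h4]]]]] : exists a b c d : R,
    [/\ 2 * (a * c + b * d) = v 0 0, 2 * (b * c - a * d) = v 0 1,
     a ^+ 2 + b ^+ 2 - (c ^+ 2 + d ^+ 2) = v 0 2
     & a ^+ 2 + b ^+ 2 + (c ^+ 2 + d ^+ 2) = N].
  exists ((a +i* b) *: u1 + (c +i* d) *: u2).
    rewrite hnormE !linearDl /= !linearZl_LR /= u11 u22 u12 u21.
    by rewrite !mulr1 !mulr0 add0r addr0.
  rewrite /bloch !linearDl /= !linearZl_LR /= u11 u22 u12 u21.
  rewrite !mulr1 !mulr0 add0r addr0 /= h1 h2 h3.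
  by apply/rowP; apply: forall_ord3; rewrite !vec3E.
have n2 : N ^+ 2 - v 0 2 ^+ 2 = v 0 0 ^+ 2 + v 0 1 ^+ 2 by rewrite -vN; ring.
have leN : `|v 0 2| <= N.
  rewrite -[N]ger0_norm // -ler_sqr ?nnegrE // !real_normK ?num_real //.
  by rewrite -subr_ge0 n2 addr_ge0 ?sqr_ge0.
move: leN; rewrite ler_norml => /andP[leN1 leN2].
have [z|nz] := eqVneq (N + v 0 2) 0.
  have : v 0 0 ^+ 2 + v 0 1 ^+ 2 = 0 by rewrite -n2 subr_sqr z mulr0.
  move/eqP; rewrite paddr_eq0 ?sqr_ge0 // !sqrf_eq0 => /andP[/eqP -> /eqP ->].
  exists 0, 0, (Num.sqrt N), 0; rewrite sqr_sqrtr //.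
  by split; [ring|ring|lra|ring].
have p0 : 0 < (N + v 0 2) / 2 by lra.
pose s := Num.sqrt ((N + v 0 2) / 2).
have s2 : s ^+ 2 = (N + v 0 2) / 2 by rewrite sqr_sqrtr // ltW.
have s0 : s != 0 by rewrite gt_eqF // sqrtr_gt0.
have cd : (v 0 0 / (2 * s)) ^+ 2 + (- v 0 1 / (2 * s)) ^+ 2 = (N - v 0 2) / 2.
  rewrite !expr_div_n exprMn s2 sqrrN -mulrDl -n2.
  by field.
exists s, 0, (v 0 0 / (2 * s)), (- v 0 1 / (2 * s)).
split; [by field|by field|rewrite cd s2; lra|rewrite cd s2; lra].
Qed.

Lemma Re_sum n (F : 'I_n -> R[i]) :
  complex.Re (\sum_i F i) = \sum_i complex.Re (F i).
Proof. by apply: (big_morph (@complex.Re R)) => [[a b] [c d]|]. Qed.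

Lemma Im_sum n (F : 'I_n -> R[i]) :
  complex.Im (\sum_i F i) = \sum_i complex.Im (F i).
Proof. by apply: (big_morph (@complex.Im R)) => [[a b] [c d]|]. Qed.

Lemma sum_rank_one_scalar n (f : 'I_n -> H) (t : R) :
  \sum_j rank_one form (f j) (f j) = t%:C *: (\1%VF : 'End(H)) <->
  \sum_j hnorm form (f j) ^+ 2 = 2 * t /\ \sum_j bloch (f j) = 0.
Proof.
pose G (z w : H) := \sum_j form z (f j) * form (f j) w.
have opE z w : form ((\sum_j rank_one form (f j) (f j)) z) w = G z w.
  rewrite sum_lfunE linear_sumlz; apply: eq_bigr => j _.
  by rewrite rank_oneE linearZl_LR.
(* The operator is scalar when its matrix entries in the basis (u1, u2) are. *)
have -> : \sum_j rank_one form (f j) (f j) = t%:C *: (\1%VF : 'End(H)) <->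
  [/\ G u1 u1 = t%:C, G u2 u2 = t%:C, G u2 u1 = 0 & G u1 u2 = 0].
  split=> [E|[g11 g22 g21 g12]].
    by rewrite -!opE E; split; rewrite scale_lfunE id_lfunE linearZl_LR /=
      ?u11 ?u22 ?u12 ?u21 ?mulr1 ?mulr0.
  apply/lfunP => z; rewrite scale_lfunE id_lfunE.
  move: opE; set S := \sum_j _ => opE.
  have S1 : S u1 = t%:C *: u1 by rewrite [LHS]uE !opE g11 g12 scale0r addr0.
  have S2 : S u2 = t%:C *: u2 by rewrite [LHS]uE !opE g22 g21 scale0r add0r.
  rewrite (uE z) linearD !linearZ /= S1 S2.
  by rewrite scalerDr !scalerA ![t%:C * _]mulrC.
have G11 : G u1 u1 =
  (\sum_j (complex.Re (form (f j) u1) ^+ 2 + complex.Im (form (f j) u1) ^+ 2))%:C.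
  rewrite rmorph_sum; apply: eq_bigr => j _ /=.
  by rewrite add_Re2_Im2 normCK mulrC [form u1 _]formC.
have G22 : G u2 u2 =
  (\sum_j (complex.Re (form (f j) u2) ^+ 2 + complex.Im (form (f j) u2) ^+ 2))%:C.
  rewrite rmorph_sum; apply: eq_bigr => j _ /=.
  by rewrite add_Re2_Im2 normCK mulrC [form u2 _]formC.
have G12 : G u1 u2 = (G u2 u1)^*%R.
  rewrite rmorph_sum; apply: eq_bigr => j _.
  by rewrite mulrC [form u1 _]formC [form _ u2]formC -rmorphM.
have G21re : complex.Re (G u2 u1) = \sum_j
  (complex.Re (form (f j) u1) * complex.Re (form (f j) u2)
   + complex.Im (form (f j) u1) * complex.Im (form (f j) u2)).
  rewrite Re_sum; apply: eq_bigr => j _; rewrite [form u2 _]formC.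
  by case: (form (f j) u1) (form (f j) u2) => a b [c d] /=; ring.
have G21im : complex.Im (G u2 u1) = \sum_j
  (complex.Im (form (f j) u1) * complex.Re (form (f j) u2)
   - complex.Re (form (f j) u1) * complex.Im (form (f j) u2)).
  rewrite Im_sum; apply: eq_bigr => j _; rewrite [form u2 _]formC.
  by case: (form (f j) u1) (form (f j) u2) => a b [c d] /=; ring.
have S0 : (\sum_j bloch (f j)) 0 0 = 2 * complex.Re (G u2 u1).
  rewrite summxE G21re mulr_sumr; by apply: eq_bigr => j _; rewrite vec3E.
have S1 : (\sum_j bloch (f j)) 0 1 = 2 * complex.Im (G u2 u1).
  rewrite summxE G21im mulr_sumr; by apply: eq_bigr => j _; rewrite vec3E.
have S2 : (\sum_j bloch (f j)) 0 2 =
  \sum_j (complex.Re (form (f j) u1) ^+ 2 + complex.Im (form (f j) u1) ^+ 2)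
  - \sum_j (complex.Re (form (f j) u2) ^+ 2 + complex.Im (form (f j) u2) ^+ 2).
  rewrite summxE -sumrB; by apply: eq_bigr => j _; rewrite vec3E.
have SN : \sum_j hnorm form (f j) ^+ 2 =
  \sum_j (complex.Re (form (f j) u1) ^+ 2 + complex.Im (form (f j) u1) ^+ 2)
  + \sum_j (complex.Re (form (f j) u2) ^+ 2 + complex.Im (form (f j) u2) ^+ 2).
  by rewrite -big_split; apply: eq_bigr => j _; rewrite hnormE.
rewrite G12 G11 G22 SN; move: G11 G22 => _ _.
move: (G u2 u1) S0 S1 => g S0 S1; move: (\sum_j (_ ^+ 2 + _)) S2 {SN}
 => X; move: (\sum_j (_ ^+ 2 + _)) => Y S2.
split=> [[/complexI XE /complexI YE gE _]|[XY V0]].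
  split; first by rewrite XE YE; ring.
  apply/rowP; apply: forall_ord3; rewrite mxE ?S0 ?S1 ?S2 ?gE ?XE ?YE /=; ring.
have g0 : g = 0.
  move: S0 S1; rewrite V0 !mxE; case: g => a b /= E1 E2.
  by congr (_ +i* _); lra.
move: S2; rewrite V0 mxE g0 rmorph0 => S2.
by split=> //; congr (_%:C); lra.
Qed.
End Basis.
End Bloch.

(** * The nine vectors *)

(** Off the diagonal this follows from the inequality of row i, which bounds
    b i * b j by 1. *)
Lemma len_ge0 (R : rcfType) (b : 'I_3 -> R) : (forall i, 0 <= b i) ->
  (forall i, 0 <= 1 - b i * (1 + (b 0 + b 1 + b 2 - b i))) ->
  forall i j, 0 <= len b i j.
Proof.
move=> b0 sl i j; rewrite /len.
have le_sum (s t : 'I_3) : s != t -> b t <= b 0 + b 1 + b 2 - b s.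
  by move: s t; do 2!apply: forall_ord3; rewrite // => _;
    move: (b0 0) (b0 1) (b0 2); lra.
have [_|ij] := eqVneq i j.
  rewrite mulr_ge0 // addr_ge0 //.
  by move: i; apply: forall_ord3; move: (b0 0) (b0 1) (b0 2); lra.
apply: le_trans (sl i) _; rewrite lerB // ler_wpM2l //.
by rewrite (le_trans (le_sum _ _ ij)) // lerDr.
Qed.

Theorem theorem6p1 (R : realType)
    (H : vectType R[i]) (form : {dot H for Num.Def.conjC}) (dimH : \dim {:H} = 2%N)
    (alpha : 'I_3 -> R) (alpha_gt0 : forall i : 'I_3, 0 < alpha i)
    (lambda : R) (lambdaE : lambda = alpha 0 + alpha 1 + alpha 2) :
  (exists e : 'I_3 -> 'I_3 -> H,
    [/\ forall i : 'I_3,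
          hnorm form (e i i) ^+ 2 = (lambda - alpha i) * (lambda * alpha i - 1),
        forall i j : 'I_3, i != j ->
          hnorm form (e i j) ^+ 2
            = alpha i + alpha j - lambda * alpha i * alpha j,
        forall i : 'I_3,
          \sum_(j < 3) rank_one form (e i j) (e i j)
            = (alpha i)%:C *: (\1%VF : 'End(H))
      & forall j : 'I_3,
          \sum_(i < 3) rank_one form (e i j) (e i j)
            = (alpha j)%:C *: (\1%VF : 'End(H))])
  <->
  [/\ forall i : 'I_3, 0 <= lambda * alpha i - 1,
      forall i : 'I_3, 0 <= alpha i ^+ 2 - lambda * alpha i + 1
    & 0 <= 4 * lambda * alpha 0 * alpha 1 * alpha 2
           - 4 * (alpha 0 * alpha 1 + alpha 0 * alpha 2 + alpha 1 * alpha 2)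
           + 3].
Proof.
have [u1 [u2 hu]] := onb_exists form dimH.
have a0 := alpha_gt0 0; have a1 := alpha_gt0 1; have a2 := alpha_gt0 2.
have l0 : 0 < lambda by rewrite lambdaE; lra.
have l2 : 0 < lambda ^+ 2 by rewrite exprn_gt0.
pose b i := lambda * alpha i - 1.
have sumb : b 0 + b 1 + b 2 = lambda ^+ 2 - 3 by rewrite /b lambdaE; ring.
have slackE i : 1 - b i * (1 + (b 0 + b 1 + b 2 - b i))
    = lambda ^+ 2 * (alpha i ^+ 2 - lambda * alpha i + 1).
  by rewrite sumb /b; ring.
have cubicE : cubic (b 0) (b 1) (b 2) = lambda ^+ 2 *
    (4 * lambda * alpha 0 * alpha 1 * alpha 2
     - 4 * (alpha 0 * alpha 1 + alpha 0 * alpha 2 + alpha 1 * alpha 2) + 3).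
  by rewrite /cubic /b lambdaE; ring.
have lenii i :
    len b i i = lambda * ((lambda - alpha i) * (lambda * alpha i - 1)).
  by rewrite /len eqxx sumb /b; ring.
have lenij i j : i != j ->
    len b i j = lambda * (alpha i + alpha j - lambda * alpha i * alpha j).
  by move=> /negPf ij; rewrite /len ij /b; ring.
have lenC i j : len b i j = len b j i.
  rewrite /len eq_sym; case: eqVneq => [->//|_]; by rewrite [b i * _]mulrC.
have len_sum i : \sum_j len b i j = lambda * (2 * alpha i).
  by move: i; apply: forall_ord3; rewrite sum_ord3 /len /= /b lambdaE; ring.
split.
  move=> [e [eii eij rows cols]].
  have b0 i : 0 <= b i.
    have : 0 <= (lambda - alpha i) * (lambda * alpha i - 1).
      by rewrite -eii sqr_ge0.
    rewrite pmulr_rge0 // subr_gt0 lambdaE.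
    by move: i; apply: forall_ord3; lra.
  have [] := (config_iff b0).1.
    exists (fun i j => lambda *: bloch form u1 u2 (e i j)).
      split=> i; rewrite -scaler_sumr.
        have [_ ->] := (sum_rank_one_scalar hu _ _).1 (rows i).
        by rewrite scaler0.
      have [_ ->] := (sum_rank_one_scalar hu _ _).1 (cols i).
      by rewrite scaler0.
    move=> i j; rewrite dotZl dotC dotZl (bloch_norm hu) mulrA -expr2 -exprMn.
    by have [<-|ij] := eqVneq i j; rewrite ?eii ?lenii // eij // lenij.
  move=> sl; rewrite cubicE pmulr_rge0 // => c0; split=> // i.
  by have := sl i; rewrite slackE pmulr_rge0.
move=> [b0 ii iii].
have sl i : 0 <= 1 - b i * (1 + (b 0 + b 1 + b 2 - b i)).
  by rewrite slackE mulr_ge0 // ltW.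
have [w [rows cols] wlen] : exists2 w, magic0 w &
    forall i j, dot (w i j) (w i j) = len b i j ^+ 2.
  by apply/(config_iff b0); split; rewrite // cubicE mulr_ge0 // ltW.
have ln0 : lambda != 0 by rewrite gt_eqF.
have /fin_all_exists[e eE] : forall i, exists ei : 'I_3 -> H, forall j,
    hnorm form (ei j) ^+ 2 = lambda^-1 * len b i j
    /\ bloch form u1 u2 (ei j) = lambda^-1 *: w i j.
  move=> i; apply: (@fin_all_exists _ _ (fun j f =>
    hnorm form f ^+ 2 = lambda^-1 * len b i j
    /\ bloch form u1 u2 f = lambda^-1 *: w i j)) => j.
  have N0 : 0 <= lambda^-1 * len b i j.
    by rewrite mulr_ge0 ?invr_ge0 ?len_ge0 // ltW.
  have [|f fN fv] := bloch_surj hu (v := lambda^-1 *: w i j) N0.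
    by rewrite dotZl dotC dotZl wlen; ring.
  by exists f.
exists e; split=> [i|i j ij|i|j].
- by rewrite (eE i i).1 lenii mulKf.
- by rewrite (eE i j).1 lenij // mulKf.
- apply/(sum_rank_one_scalar hu); split.
    rewrite (eq_bigr (fun j => lambda^-1 * len b i j)) => [|j _].
      by rewrite -mulr_sumr len_sum mulKf.
    by rewrite (eE i j).1.
  rewrite (eq_bigr (fun j => lambda^-1 *: w i j)) => [|j _].
    by rewrite -scaler_sumr rows scaler0.
  by rewrite (eE i j).2.
- apply/(sum_rank_one_scalar hu); split.
    rewrite (eq_bigr (fun i => lambda^-1 * len b j i)) => [|i _].
      by rewrite -mulr_sumr len_sum mulKf.
    by rewrite (eE i j).1 lenC.
  rewrite (eq_bigr (fun i => lambda^-1 *: w i j)) => [|i _].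
    by rewrite -scaler_sumr cols scaler0.
  by rewrite (eE i j).2.
Qed.
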